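(* Let $\Gamma$ be the vertex–edge graph of the regular triangular tiling of the hyperbolic plane in which seven triangles meet at every vertex, fix a vertex $O$, and let $L(v)$ be the graph distance from $v$ to $O$ in $\Gamma$. For $m\in\mathbb{N}$ let $\Gamma_m=\{v: L(v)\le m\}$. For every non-empty $P\subset\Gamma_m$, the toppling function of the state $\phi_m^P=6+\sum_{p\in P}\delta_p$ on $\Gamma_m$ satisfies, for all $v\in\Gamma_m$, $$\mathcal{T}_{\phi_m^P}(v)=\min\bigl(m+1-L(v),\,m+1-L(P)\bigr),$$ where $L(P)=\min_{p\in P}L(p)$.
   Context: Graph: Take a hyperbolic triangle $\Delta\subset\mathbb{H}^2$ with all three angles equal to $2\pi/7$; the group generated by reflections in its sides tiles $\mathbb{H}^2$ by copies of $\Delta$. $\Gamma$ is the graph whose vertices and edges are the images of the vertices and edges of $\Delta$; it is $7$-regular. $n(v)$ denotes the set of the $7$ neighbours of $v$ in $\Gamma$, and $\delta_v$ is the function equal to $1$ at $v$ and $0$ elsewhere. Sandpile on $\Gamma_m$: a state is a function $\phi:\Gamma_m\to\mathbb{Z}_{\ge0}$. The toppling at $v\in\Gamma_m$ is $T_v\phi(u)=\phi(u)+\Delta\delta_v(u)$, where $\Delta f(w)=-7f(w)+\sum_{u\in n(w)\cap\Gamma_m}f(u)$ (so toppling $v$ removes 7 grains from $v$ and adds one grain to each neighbour of $v$ lying in $\Gamma_m$; grains sent outside $\Gamma_m$ are lost). A toppling at $v$ is legal if $\phi(v)\ge7$; a state is stable if $\phi(v)<7$ for all $v$. A relaxation of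 $\psi_0$ is a sequence of legal topplings $\psi_0,\psi_1,\dots,\psi_N$ ending at a stable state; it always exists, its final state $\psi_0^\circ$ is independent of the choices, and so is the toppling function $\mathcal{T}_{\psi_0}(v)$ = the number of topplings performed at $v$ in a relaxation of $\psi_0$. The maximal stable state is $\phi_m\equiv6$ on $\Gamma_m$, and for non-empty $P\subset\Gamma_m$, $\phi_m^P=\phi_m+\sum_{v\in P}\delta_v$. *)

(* Defs.v *)
From HB Require Import structures.
From mathcomp Require Import all_boot all_order all_algebra.
From mathcomp Require Import all_classical all_reals all_analysis.
Set Implicit Arguments. Unset Strict Implicit. Unset Printing Implicit Defensive.
Import Order.TTheory GRing.Theory Num.Theory.
Local Open Scope ring_scope.

(* Hyperboloid model of the hyperbolic plane:
   H^2 = { x in R^3 | <x,x> = -1, x_2 > 0 } with the Minkowski form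
   <x,y> = x0 y0 + x1 y1 - x2 y2.  Points are row vectors 'rV[R]_3. *)
Section Hyperbolic.
Variable R : realType.
Notation pt := 'rV[R]_3.

Definition mink (x y : pt) : R :=
  x 0 0 * y 0 0 + x 0 1 * y 0 1 - x 0 2 * y 0 2.

Definition inH2 (x : pt) : Prop := mink x x = -1 /\ 0 < x 0 2.

(* Minkowski normal of the plane spanned by p and q: J (p x q), J = diag(1,1,-1). *)
Definition mnormal (p q : pt) : pt :=
  \row_(i < 3) [:: p 0 1 * q 0 2 - p 0 2 * q 0 1;
                   p 0 2 * q 0 0 - p 0 0 * q 0 2;
                   - (p 0 0 * q 0 1 - p 0 1 * q 0 0)]`_i.

Definition hrefl (p q : pt) (x : pt) : pt :=
  let n := mnormal p q in x - ((2 * mink x n) / mink n n) *: n.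

(* Cosine of the hyperbolic angle at vertex a of the triangle abc
   (tangent vectors at a towards b and c are b + <a,b>a and c + <a,c>a). *)
Definition cos_angle (a b c : pt) : R :=
  let u := b + mink a b *: a in
  let w := c + mink a c *: a in
  mink u w / Num.sqrt (mink u u * mink w w).

(* Triangle with vertices tri 0, tri 1, tri 2; side i is the side opposite
   vertex i, and s_i is the reflection in (the geodesic carrying) side i. *)
Definition side_refl (tri : 'I_3 -> pt) (i : 'I_3) : pt -> pt :=
  hrefl (tri (i + 1)) (tri (i + 2)).

Definition act (tri : 'I_3 -> pt) (w : seq 'I_3) (x : pt) : pt :=
  foldr (fun i y => side_refl tri i y) x w.

Definition gvertex (tri : 'I_3 -> pt) (x : pt) : Prop :=
  exists w i, x = act tri w (tri i).

Definition gadj (tri : 'I_3 -> pt) (x y : pt) : Prop :=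
  exists w i j, i != j /\ x = act tri w (tri i) /\ y = act tri w (tri j).

Fixpoint within (tri : 'I_3 -> pt) (n : nat) (x y : pt) : Prop :=
  match n with
  | 0 => x = y
  | k.+1 => x = y \/ exists z, gadj tri x z /\ within tri k z y
  end.

Definition gdist (tri : 'I_3 -> pt) (O v : pt) (l : nat) : Prop :=
  within tri l O v /\ forall k, within tri k O v -> (l <= k)%N.

Definition inGm (tri : 'I_3 -> pt) (O : pt) (m : nat) (v : pt) : Prop :=
  within tri m O v.

Definition gdistP (tri : 'I_3 -> pt) (O : pt) (P : seq pt) (l : nat) : Prop :=
  (exists2 p, p \in P & gdist tri O p l) /\
  (forall p k, p \in P -> gdist tri O p k -> (l <= k)%N).

(* Sandpile on Gamma_m.  States are int-valued functions (only the values on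
   Gamma_m matter).  Toppling at v: T_v phi (u) = phi u + (Delta delta_v)(u)
   = phi u - 7 [u = v] + [u in Gamma_m and u ~ v]. *)
Definition topple (tri : 'I_3 -> pt) (O : pt) (m : nat)
    (phi : pt -> int) (v : pt) : pt -> int :=
  fun u => phi u - (7 * (u == v))%:Z
             + (`[< gadj tri v u /\ inGm tri O m u >] : nat)%:Z.

Fixpoint legal_seq (tri : 'I_3 -> pt) (O : pt) (m : nat)
    (phi : pt -> int) (s : seq pt) : Prop :=
  match s with
  | [::] => True
  | v :: s' => inGm tri O m v /\ (7 <= phi v)%R /\
               legal_seq tri O m (topple tri O m phi v) s'
  end.

Definition final_state (tri : 'I_3 -> pt) (O : pt) (m : nat)
    (phi : pt -> int) (s : seq pt) : pt -> int :=
  foldl (topple tri O m) phi s.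

Definition stable (tri : 'I_3 -> pt) (O : pt) (m : nat) (phi : pt -> int) : Prop :=
  forall v, inGm tri O m v -> (phi v < 7)%R.

Definition relaxation (tri : 'I_3 -> pt) (O : pt) (m : nat)
    (phi : pt -> int) (s : seq pt) : Prop :=
  legal_seq tri O m phi s /\ stable tri O m (final_state tri O m phi s).

(* phi_m^P = 6 + sum_{p in P} delta_p  (P given as a duplicate-free list) *)
Definition phimP (P : seq pt) : pt -> int :=
  fun u => (6 + count_mem u P)%:Z.

End Hyperbolic.

(* Main.v *)
Require Import Defs.
From HB Require Import structures.
From mathcomp Require Import all_boot all_order all_algebra.
From mathcomp Require Import all_classical all_reals all_analysis.
From mathcomp Require Import ring lra zify.
Set Implicit Arguments. Unset Strict Implicit. Unset Printing Implicit Defensive.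
Import Order.TTheory GRing.Theory Num.Theory.
Local Open Scope ring_scope.

(** Let [e = 2 cos (2 pi / 7)].  Reflecting the vertex [b] of a triangle [(v, a, b)] of
    the tiling in the side [va] gives [e (v + a) - b], so consecutive neighbours of [v]
    satisfy a linear recurrence, and so do the hyperbolic cosines [D] of their distances
    to [O].  This recurrence shows that if [a] is a neighbour of [v] closest to [O], then
    [D] exceeds [D v] at the four neighbours of [v] not adjacent to [a].  By induction
    along galleries issued from [O], every vertex other than [O] has a closest neighbour
    one level below it and strictly closer to [O]; in particular a gallery leading back
    to the point [O] ends in the star of [O], so the graph is 7-regular (no discreteness
    theorem for reflection groups is needed), and each vertex other than [O] has at most
    two neighbours one level below and at least three one level above.

    Hence the claimed function has Laplacian at most [0], and at most [-1] on [P], so by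
    the least action principle it bounds every legal toppling sequence.  Conversely, the
    toppling function of a relaxation is superharmonic, strictly so on [P], and the
    minimum principle on the balls of radius at least [L(P)] gives the lower bound. *)

(** * Triangles and stars *)

Section Frames.
Variable R : realType.
Notation pt := 'rV[R]_3.
Implicit Types (v a b x y : pt).
(** [C] is the hyperbolic cosine of the side length, and [e_cubic] is the minimal polynomial of
    [2 cos (2 pi / 7)]; all later arguments use only these four hypotheses. *)
Variables (e C : R).
Hypothesis e_gt1 : 1 < e.
Hypothesis e_cubic : e ^+ 3 + e ^+ 2 - 2 * e - 1 = 0.
Hypothesis C_eq : C * (2 - e) = e.
Hypothesis C_gt1 : 1 < C.

Lemma minkC x y : mink x y = mink y x.
Proof. by rewrite /mink; ring. Qed.

(* The reflection of [b] in the line [va], when [(v, a, b)] is equilateral with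
   side length [arcosh C]. *)
Definition mirror v a b : pt := e *: (v + a) - b.

(** The neighbours of [v] in cyclic order, starting from [a], [b]. The index is unbounded; [nbr7]
    shows that the sequence has period 7. *)
Fixpoint nbr v a b (j : nat) : pt :=
  if j is i.+1 then nbr v b (mirror v b a) i else a.

Lemma mink_mirror x v a b : mink x (mirror v a b) = e * (mink x v + mink x a) - mink x b.
Proof. by rewrite /mink /mirror !mxE; ring. Qed.

Lemma mirrorK v a b : mirror v a (mirror v a b) = b.
Proof. by apply/rowP => i; rewrite /mirror !mxE; ring. Qed.

Lemma mirrorC v a b : mirror v a b = mirror a v b.
Proof. by rewrite /mirror [v + a]addrC. Qed.

Lemma nbrSS v a b j : nbr v a b j.+2 = mirror v (nbr v a b j.+1) (nbr v a b j).
Proof. by elim: j a b => // j IH a b; rewrite -[LHS]/(nbr v b _ j.+2) IH. Qed.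

Lemma nbr_pred v a b j : nbr v a b j = mirror v (nbr v a b j.+1) (nbr v a b j.+2).
Proof. by rewrite nbrSS mirrorK. Qed.

(** The recurrence has characteristic roots [exp (+- 2 pi i / 7)], so four steps forward agree with
    three steps backward: the difference of the two sides is the cubic times [b - a]. *)
Lemma nbr4 v a b : nbr v a b 4 = mirror v (mirror v (mirror v a b) a) (mirror v a b).
Proof.
apply/rowP => i; rewrite /= /mirror !mxE; apply/eqP; rewrite -subr_eq0.
by apply/eqP; rewrite -[RHS](mul0r (b 0 i - a 0 i)) -e_cubic; ring.
Qed.

Lemma nbr5 v a b : nbr v a b 5 = mirror v (mirror v a b) a.
Proof.
apply/rowP => i; rewrite /= /mirror !mxE; apply/eqP; rewrite -subr_eq0.
apply/eqP; rewrite -[RHS](mul0r ((e - 1) * b 0 i - a 0 i + e * v 0 i)) -e_cubic.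
by ring.
Qed.

Lemma nbr6 v a b : nbr v a b 6 = mirror v a b.
Proof.
rewrite [LHS](nbrSS _ _ _ 4) nbr5 nbr4.
by apply/rowP => i; rewrite /mirror !mxE; ring.
Qed.

Lemma nbr7 v a b : nbr v a b 7 = a.
Proof. by rewrite (nbrSS _ _ _ 5) nbr6 nbr5 mirrorK. Qed.

Lemma nbrD7 v a b j : nbr v a b (j + 7) = nbr v a b j.
Proof.
elim: j a b => [|j IH] a b; first exact: nbr7.
by rewrite addSn; exact: IH.
Qed.

Lemma nbr_mod v a b j : nbr v a b (j %% 7) = nbr v a b j.
Proof.
rewrite {2}(divn_eq j 7) addnC; elim: (j %/ 7)%N => [|k IH]; first by rewrite addn0.
by rewrite mulSn addnCA addnC nbrD7.
Qed.

Lemma nbrS_mod v a b j : nbr v a b (j %% 7).+1 = nbr v a b j.+1.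
Proof. exact: (nbr_mod v b (mirror v b a) j). Qed.

(** The ordered triangles around [v], generated by the two moves of a gallery that keep its base
    vertex. *)
Inductive star v : pt -> pt -> pt -> pt -> Prop :=
| star_id a b : star v a b a b
| star_swap a b a' b' : star v a b a' b' -> star v a b b' a'
| star_refl a b a' b' : star v a b a' b' -> star v a b (mirror v b' a') b'.

Lemma star_trans v a b a' b' a'' b'' :
  star v a b a' b' -> star v a' b' a'' b'' -> star v a b a'' b''.
Proof.
move=> h h'; elim: h' h => [//|{}a' {}b' {}a'' {}b'' _ IH|{}a' {}b' {}a'' {}b'' _ IH] h.
- exact/star_swap/IH.
- exact/star_refl/IH.
Qed.

Lemma star_sym v a b a' b' : star v a b a' b' -> star v a' b' a b.
Proof.
elim=> [{}a {}b|{}a {}b {}a' {}b' _ IH|{}a {}b {}a' {}b' _ IH].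
- exact: star_id.
- by apply: star_trans IH; exact/star_swap/star_id.
- by apply: star_trans IH; rewrite -{2}(mirrorK v b' a'); exact/star_refl/star_id.
Qed.

Lemma star_mirror v a b : star v a b a (mirror v a b).
Proof. exact/star_swap/star_refl/star_swap/star_id. Qed.

Lemma star_nbr v a b j : star v a b (nbr v a b j) (nbr v a b j.+1).
Proof.
elim: j => [|j IH]; first exact: star_id.
by rewrite nbrSS; apply/star_swap/star_refl.
Qed.

(** The moves act as a dihedral group on the heptagon around [v], so a pair always consists of
    cyclically consecutive neighbours. The [mirror] alternative is the predecessor of [a']. *)
Lemma star_nbrP v a b a' b' : star v a b a' b' ->
  exists2 j, (j < 7)%N & a' = nbr v a b j /\
    (b' = nbr v a b j.+1 \/ b' = mirror v a' (nbr v a b j.+1)).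
Proof.
have key : star v a b a' b' -> exists j,
    (a' = nbr v a b j /\ b' = nbr v a b j.+1) \/
    (a' = nbr v a b j.+1 /\ b' = nbr v a b j).
  elim=> {a b a' b'} [a b|a b a' b' _ [j IH]|a b a' b' _ [j IH]].
  - by exists 0; left.
  - by exists j; case: IH => -[-> ->]; [right|left].
  - case: IH => -[-> ->].
      by exists j.+1; right; rewrite nbrSS.
    exists (j + 6)%N; left; split; last by rewrite -addnS nbrD7.
    by rewrite [RHS]nbr_pred -!addnS nbrD7 -[in RHS]addSnnS nbrD7.
case/key => j [] [ea eb].
  exists (j %% 7)%N; first by rewrite ltn_mod.
  by rewrite nbr_mod nbrS_mod; split=> //; left.
exists (j.+1 %% 7)%N; first by rewrite ltn_mod.
by rewrite nbr_mod nbrS_mod; split=> //; right; rewrite ea eb -nbr_pred.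
Qed.

Lemma nbr_mirror v a b j : (j < 8)%N ->
  nbr v a (mirror v a b) j = nbr v a b (7 - j).
Proof.
case: j => [|[|[|[|[|[|[|[|//]]]]]]]] _.
- by rewrite nbr7.
- by rewrite nbr6.
- by rewrite nbr5.
- by rewrite nbr4.
- by rewrite nbr4 mirrorK.
- by rewrite nbr5 mirrorK.
- by rewrite nbr6 mirrorK.
- by rewrite nbr7.
Qed.

(** Replacing [b] by its mirror image reverses the cyclic order and sends index [j] to [7 - j], so
    half of the heptagon suffices. *)
Lemma star_halfP v a b a' b' : star v a b a' b' ->
  exists b1 j, [/\ (j < 4)%N, star v a b a b1,
    b1 = b \/ b1 = mirror v a b, a' = nbr v a b1 j &
    b' = nbr v a b1 j.+1 \/ b' = mirror v a' (nbr v a b1 j.+1)].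
Proof.
case/star_nbrP => j lt_j [ea eb]; case: (ltnP j 4) => [lt4|ge4].
  by exists b, j; split=> //; [exact: star_id|left].
exists (mirror v a b), (7 - j)%N; split; [by lia|exact: star_mirror|by right| |].
  by rewrite nbr_mirror ?subKn //; lia.
rewrite nbr_mirror; last by lia.
rewrite (_ : 7 - (7 - j).+1 = j.-1)%N; last by lia.
case: j ge4 {lt_j} ea eb => // j _ ea; rewrite nbrSS -ea [j.+1.-1]/=.
by case=> ->; [right|left]; rewrite ?mirrorK.
Qed.

(** Otherwise the planar Cauchy-Schwarz inequality would give [x3^2 y3^2 <= (x3^2 - 1) (y3^2 - 1)]
    with [x3^2, y3^2 >= 1]. *)
Lemma inH2_mink_lt0 x y : inH2 x -> inH2 y -> mink x y < 0.
Proof.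
rewrite /inH2 /mink => -[hx x2] [hy y2].
set x0 := x 0 0 in hx *; set x1 := x 0 1 in hx *; set x3 := x 0 2 in hx x2 *.
set y0 := y 0 0 in hy *; set y1 := y 0 1 in hy *; set y3 := y 0 2 in hy y2 *.
rewrite subr_lt0 ltNge; apply/negP => le_s.
have xy_gt0 : 0 < x3 * y3 by exact: mulr_gt0.
have : (x3 * y3) ^+ 2 <= (x0 * y0 + x1 * y1) ^+ 2.
  by rewrite ler_sqr ?nnegrE ?(ltW xy_gt0) // (le_trans (ltW xy_gt0)).
have -> : (x0 * y0 + x1 * y1) ^+ 2 =
   (x0 * x0 + x1 * x1) * (y0 * y0 + y1 * y1) - (x0 * y1 - x1 * y0) ^+ 2 by ring.
have -> : x0 * x0 + x1 * x1 = x3 * x3 - 1 by lra.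
have -> : y0 * y0 + y1 * y1 = y3 * y3 - 1 by lra.
have : 1 <= x3 * x3 by nra.
have : 1 <= y3 * y3 by nra.
have := sqr_ge0 (x0 * y1 - x1 * y0); nra.
Qed.

(** If [y] were on the lower sheet, [- y] would be in the upper one and the sign of [mink x (- y)]
    would be wrong. *)
Lemma same_sheet x y : inH2 x -> mink y y = -1 -> mink x y < 0 -> inH2 y.
Proof.
move=> hx hy xy; split=> //; rewrite ltNge; apply/negP; rewrite le_eqVlt.
case/orP => [/eqP y2|y2]; first by move: hy; rewrite /mink y2; nra.
suff /(inH2_mink_lt0 hx) : inH2 (- y).
  suff -> : mink x (- y) = - mink x y by lra.
  by rewrite /mink !mxE; ring.
split; last by rewrite mxE oppr_gt0.
by rewrite -hy /mink !mxE; ring.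
Qed.

(** * Equilateral triangles and galleries *)

Definition gram v a b : Prop :=
  [/\ inH2 v, inH2 a, inH2 b & [/\ mink v a = - C, mink v b = - C & mink a b = - C]].

Lemma gram_swap v a b : gram v a b -> gram v b a.
Proof. by case=> ? ? ? [? ? ?]; split=> //; split; rewrite // minkC. Qed.

Lemma gram_turn v a b : gram v a b -> gram a v b.
Proof. by case=> ? ? ? [? ? ?]; split=> //; split; rewrite // minkC. Qed.

Lemma gram_refl v a b : gram v a b -> gram v (mirror v b a) b.
Proof.
case=> hv ha hb [va vb ab].
have [vv _] := hv; have [aa _] := ha; have [bb _] := hb.
have eC : e * (1 + C) = 2 * C by have := C_eq; lra.
have hvx : mink v (mirror v b a) = - C by rewrite mink_mirror vv va vb; lra.
have hbx : mink b (mirror v b a) = - C.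
  by rewrite mink_mirror (minkC b v) (minkC b a) vb bb ab; lra.
have hax : mink a (mirror v b a) < 0.
  by rewrite mink_mirror (minkC a v) aa ab va; have := e_gt1; have := C_gt1; nra.
split=> //; last by split; rewrite // minkC.
apply: (same_sheet ha) => //.
rewrite mink_mirror !(minkC (mirror v b a)) hvx hbx mink_mirror (minkC a v) aa ab va; lra.
Qed.

(* Only the moves that change the base vertex are counted. *)
Inductive reach (o a0 b0 : pt) : nat -> pt -> pt -> pt -> Prop :=
| reach_base : reach o a0 b0 0 o a0 b0
| reach_swap n v a b : reach o a0 b0 n v a b -> reach o a0 b0 n v b a
| reach_refl n v a b : reach o a0 b0 n v a b -> reach o a0 b0 n v (mirror v b a) b
| reach_turn n v a b : reach o a0 b0 n v a b -> reach o a0 b0 n.+1 a v b.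

Lemma reach_star o a0 b0 n v a b a' b' :
  star v a b a' b' -> reach o a0 b0 n v a b -> reach o a0 b0 n v a' b'.
Proof.
by elim=> // {a b a' b'} a b a' b' _ IH /IH; [exact: reach_swap|exact: reach_refl].
Qed.

Lemma reach_inv o a0 b0 n v a b : reach o a0 b0 n v a b ->
  if n is n'.+1 then
    exists u c, reach o a0 b0 n' u v c /\ star v u c a b
  else v = o /\ star o a0 b0 a b.
Proof.
elim=> {n v a b} [|n v a b _|n v a b _|n v a b h _].
- by split=> //; exact: star_id.
- case: n => [[-> h]|n [u [c [h1 h2]]]]; first by split=> //; exact: star_swap.
  by exists u, c; split=> //; exact: star_swap.
- case: n => [[-> h]|n [u [c [h1 h2]]]]; first by split=> //; exact: star_refl.
  by exists u, c; split=> //; exact: star_refl.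
- by exists v, b; split=> //; exact: star_id.
Qed.

Lemma reach_gram o a0 b0 n v a b :
  gram o a0 b0 -> reach o a0 b0 n v a b -> gram v a b.
Proof.
move=> g0; elim=> // {n v a b} n v a b _.
- exact: gram_swap.
- exact: gram_refl.
- exact: gram_turn.
Qed.

(** * Distance to the base point and descent along galleries *)

Section Distance.
Variable o : pt.
Hypothesis ho : inH2 o.

Definition cosh_dist x := - mink o x.
Local Notation D := cosh_dist.

Lemma cosh_dist_mirror v a b : D (mirror v a b) = e * (D v + D a) - D b.
Proof. by rewrite /D mink_mirror; ring. Qed.

Lemma cosh_dist_gt0 x : inH2 x -> 0 < D x.
Proof. by move=> hx; rewrite oppr_gt0 inH2_mink_lt0. Qed.

(** [a] is compared only with the two neighbours of [v] next to it in cyclic order; [locmin_far]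
    shows how much this already controls. *)
Definition locmin v a b := D a <= D b /\ D a <= D (mirror v a b).

Lemma locmin_mirror v a b : locmin v a b -> locmin v a (mirror v a b).
Proof. by case=> h1 h2; split; rewrite ?mirrorK. Qed.

(** The two inequalities of [locmin] add up to [(2 - e) D a <= e D v]. With [e > 1], the recurrence
    then does not decrease from index 1 to 2 and exceeds [D v] at 2 and 3; reversing the order gives
    5 and 4. *)
Lemma locmin_far v a b : 0 < D v -> 0 < D a -> locmin v a b ->
  [/\ D v < D (nbr v a b 2), D v < D (nbr v a b 3),
      D v < D (nbr v a b 4) & D v < D (nbr v a b 5)].
Proof.
have main b' : 0 < D v -> 0 < D a -> locmin v a b' ->
    D v < D (nbr v a b' 2) /\ D v < D (nbr v a b' 3).
  have e1 := e_gt1; move=> v0 a0 [ab]; rewrite /= !cosh_dist_mirror => ab'.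
  have h2 : D v < e * (D v + D b') - D a by nra.
  have h3 : D b' <= e * (D v + D b') - D a by nra.
  by split=> //; nra.
move=> v0 a0 h; have [h2 h3] := main _ v0 a0 h.
have [h5 h4] := main _ v0 a0 (locmin_mirror h).
by split; rewrite // -?(@nbr_mirror _ _ _ 3) // -(@nbr_mirror _ _ _ 2).
Qed.

Lemma locmin_nbr2_turn v a b : 0 < D v -> 0 < D a -> locmin v a b ->
  D (nbr v a b 1) < D v -> locmin (nbr v a b 2) (nbr v a b 1) v.
Proof.
move=> v0 a0 h lt1; split; first exact: ltW.
have [h2 _ _ _] := locmin_far v0 a0 h.
have [h1 _] := h; move: h2 h1 lt1; rewrite /= !cosh_dist_mirror.
by have := e_gt1; nra.
Qed.

Lemma reach_gt0 a0 b0 n v a b : gram o a0 b0 -> reach o a0 b0 n v a b ->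
  [/\ 0 < D v, 0 < D a & 0 < D b].
Proof.
by move=> g /(reach_gram g) [? ? ? _]; split; exact: cosh_dist_gt0.
Qed.

Lemma reach_nbr a0 b0 n v a b j : reach o a0 b0 n v a b ->
  reach o a0 b0 n v (nbr v a b j) (nbr v a b j.+1).
Proof. exact/reach_star/star_nbr. Qed.

(** Induction on the minimal number of turns. The vertex [u] before [v] has a local minimum [a']; up
    to symmetry [v] has index [j <= 3] from [a'] around [u], and minimality pushes it to the far
    side, where [D] exceeds [D u]. *)
Lemma descent a0 b0 n v a b : gram o a0 b0 -> reach o a0 b0 n.+1 v a b ->
  (forall k, reach o a0 b0 k v a b -> (n < k)%N) ->
  exists a' b', [/\ star v a b a' b', reach o a0 b0 n a' v b',
    locmin v a' b' & D a' < D v].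
Proof.
move=> g0; elim: n v a b => [|n IH] v a b /reach_inv [u [c [ru suv]]] minv.
  have [? _] := reach_inv ru; subst u.
  have gu := reach_gram g0 ru.
  have [_ _ _ [ov oc _]] := gu; have [oo _] := ho.
  exists o, c; split; first exact: star_sym.
  - by [].
  - have := C_eq; have := C_gt1; rewrite /locmin cosh_dist_mirror /D oo ov oc; split; nra.
  - by have := C_gt1; rewrite /D oo ov; lra.
have minu k : reach o a0 b0 k u v c -> (n < k)%N.
  by move=> h; have := minv k.+1 (reach_star suv (reach_turn h)).
have [a' [b1 [su ra lmu lta]]] := IH _ _ _ ru minu.
have [b' [j [lt_j sb eb ev ec]]] := star_halfP (star_sym su).
have {}lmu : locmin u a' b'.
  by case: eb => -> //; exact: locmin_mirror.
have {}ra : reach o a0 b0 n a' u b'.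
  case: eb => [->//|->]; rewrite mirrorC; exact/reach_swap/reach_refl/reach_swap.
have ru' : reach o a0 b0 n.+1 u a' b' by exact: reach_turn.
have [u0 a'0 _] := reach_gt0 g0 ru'.
set c' := nbr u a' b' j.+1 in ec.
have {suv ec} sv : star v a b u c'.
  apply: star_trans (star_sym suv) _.
  case: ec => ->; first exact: star_id.
  by rewrite mirrorC -{2}(mirrorK v u c') ; exact: star_mirror.
have ncon k : reach o a0 b0 k v u c' -> (n.+1 < k)%N.
  by move=> h; apply: minv; exact: reach_star (star_sym sv) h.
have [far2 far3 far4 far5] := locmin_far u0 a'0 lmu.
have ruj : reach o a0 b0 n.+1 u v c' by rewrite ev; exact: reach_nbr.
have r1 : reach o a0 b0 n.+1 b' u a' by exact/reach_swap/reach_turn/reach_swap.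
case: j lt_j ev @c' sv ncon ruj => [|[|[|[|//]]]] _ ev c' sv ncon ruj.
(* [j = 0]: [v] is [a'], already reached in [n] turns. *)
- by have := ncon n; rewrite ev => /(_ ra); lia.
(* [j = 1]: [v] is adjacent to [a'], so [n + 1] turns suffice. *)
- have /ncon : reach o a0 b0 n.+1 v u c'; last by rewrite ltnn.
  by rewrite ev; apply: reach_star r1; rewrite /c' /= mirrorC; exact: star_mirror.
(* [j = 2]: [v] is adjacent to both [u] and [b'], each reached in [n + 1] turns; the one closer to
   [o] is the local minimum. *)
- have [le1|lt1] := leP (D u) (D (nbr u a' b' 1)).
    exists u, c'; split=> //; last by rewrite ev.
    split; first by rewrite ltW.
    by rewrite mirrorC ev /c' -nbr_pred.
  exists (nbr u a' b' 1), u; split.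
  + apply: star_trans sv _.
    have -> : nbr u a' b' 1 = mirror v u c' by rewrite mirrorC ev /c' -nbr_pred.
    exact/star_refl/star_swap/star_id.
  + rewrite ev; apply/reach_swap; apply: reach_star r1.
    rewrite /= mirrorC; exact: star_mirror.
  + by rewrite ev; exact: locmin_nbr2_turn.
  + by rewrite ev (lt_trans lt1).
(* [j = 3]: the common neighbours of [u] and [v] have indices 2 and 4 around [u], and both are
   farther than [u]. *)
- exists u, c'; split=> //; last by rewrite ev.
  split; first exact: ltW.
  by rewrite mirrorC ev /c' -nbr_pred ltW.
Qed.

End Distance.

(** * Composition of galleries and galleries returning to a point *)

Lemma reach_trans o a0 b0 v a b w c d n k :
  reach o a0 b0 n v a b -> reach v a b k w c d ->
  reach o a0 b0 (n + k) w c d.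
Proof.
move=> h; elim=> {w c d k} [|k w c d _ IH|k w c d _ IH|k w c d _ IH].
- by rewrite addn0.
- exact: reach_swap.
- exact: reach_refl.
- by rewrite addnS; exact: reach_turn.
Qed.

Lemma reach_sym o a0 b0 n v a b :
  reach o a0 b0 n v a b -> reach v a b n o a0 b0.
Proof.
elim=> {v a b n} [|n v a b _ IH|n v a b _ IH|n v a b _ IH].
- exact: reach_base.
- exact: reach_trans (reach_swap (reach_base _ _ _)) IH.
- rewrite -[n]add0n; apply: reach_trans IH.
  by rewrite -{2}(mirrorK v b a); exact/reach_refl/reach_base.
- rewrite -add1n; apply: reach_trans IH; exact/reach_turn/reach_base.
Qed.

Lemma reach_gt1 o a0 b0 n v a b : gram o a0 b0 -> reach o a0 b0 n.+1 v a b ->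
  (forall k, reach o a0 b0 k v a b -> (n < k)%N) -> 1 < cosh_dist o v.
Proof.
move=> g0; have [ho _ _ _] := g0.
elim: n v a b => [|n IH] v a b rv minv;
  have [a' [b' [sv ra _ lt_a]]] := descent ho g0 rv minv; apply: le_lt_trans lt_a.
  by have [-> _] := reach_inv ra; rewrite /cosh_dist (proj1 ho) opprK.
apply/ltW/(IH _ _ _ ra) => k rk; have := minv k.+1; rewrite ltnS; apply.
exact: reach_star (star_sym sv) (reach_turn rk).
Qed.

(** Take the least number of turns: were it positive, [reach_gt1] would place [v] at positive
    distance from itself. *)
Lemma reach_same_point v a b n a' b' : gram v a b -> reach v a b n v a' b' ->
  star v a b a' b'.
Proof.
move=> g0 h; have [hv _ _ _] := g0.
have ex : exists k, `[< reach v a b k v a' b' >] by exists n; exact/asboolP.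
case: (ex_minnP ex) => -[|k] /asboolP rk mink_k.
  by have [_] := reach_inv rk.
have := reach_gt1 g0 rk (fun i ri => mink_k i (asboolT ri)).
by rewrite /cosh_dist (proj1 hv) opprK ltxx.
Qed.

End Frames.

(** * Sandpiles *)

Section Sandpile.
Variable T : eqType.

Lemma count_mem_le (P : pred T) (s t : seq T) :
  (forall x, count_mem x s <= count_mem x t)%N -> (count P s <= count P t)%N.
Proof.
by move=> /count_subseqP [s' sub /permP ->]; exact: leq_count_subseq.
Qed.

Lemma count_in_seq (l t : seq T) : uniq l ->
  count (mem l) t = (\sum_(y <- l) count_mem y t)%N.
Proof.
move=> ul; elim: t => [|x t IH] /=; first by rewrite big1_seq.
rewrite IH big_split /=; congr addn.
rewrite -(count_uniq_mem x ul) -sum1_count big_mkcond /=.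
by apply: eq_bigr => y _; rewrite eq_sym; case: eqP.
Qed.

Lemma count_mem_flatten_nseq (u : T -> nat) (B : seq T) x : uniq B ->
  count_mem x (flatten [seq nseq (u y) y | y <- B]) = ((x \in B) * u x)%N.
Proof.
elim: B => //= y B IH /andP [yB uB]; rewrite count_cat count_nseq IH // in_cons.
rewrite /= eq_sym; case: eqVneq => [exy|_] //.
  by subst y; rewrite (negPf yB) mul0n addn0 mul1n.
Qed.

Lemma seq_of_family (Q : T -> T -> Prop) (s : seq T) :
  (forall z, z \in s -> exists l : seq T, forall y, Q z y -> y \in l) ->
  exists l : seq T, forall z y, z \in s -> Q z y -> y \in l.
Proof.
elim: s => [|z s IH] h; first by exists [::].
have [|l hl] := IH; first by move=> w ws; apply: h; rewrite in_cons ws orbT.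
have [l' hl'] := h z (mem_head z s); exists (l' ++ l) => w y.
rewrite in_cons mem_cat => /predU1P [->|ws] Qy; first by rewrite hl'.
by rewrite (hl w) ?orbT.
Qed.

End Sandpile.

(** * Commutation of topplings and the least action principle *)

Section Toppling.
Variables (R : realType) (tri : 'I_3 -> 'rV[R]_3) (O : 'rV[R]_3) (m : nat).
Local Notation pt := 'rV[R]_3.
Implicit Types (phi : pt -> int) (s t : seq pt).
Local Notation final := (final_state tri O m).
Local Notation legal := (legal_seq tri O m).

Definition received (u : pt) s :=
  count (fun v => `[< gadj tri v u /\ inGm tri O m u >]) s.

(** Topplings commute: only the multiplicities in [s] matter. *)
Lemma final_stateE phi s u :
  final phi s u = phi u - (7 * count_mem u s)%N%:Z + (received u s)%:Z.
Proof.
elim: s phi => [|v s IH] phi; first by rewrite /received /= muln0 subr0 addr0.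
rewrite /= [LHS]IH /topple /received /= eq_sym; lia.
Qed.

Lemma legal_rcons phi s v :
  legal phi (rcons s v) <-> [/\ legal phi s, inGm tri O m v & 7 <= final phi s v].
Proof.
elim: s phi => [|w s IH] phi /=; first by split=> [[? [? _]]|[_ ? ?]].
by rewrite IH; split=> [[? [? [? ? ?]]]|[[? [? ?]] ? ?]].
Qed.

(** Here [t] may contain illegal topplings. Before the last toppling of [s], at [v], induction says
    that [v] has received no more than under [t], yet it holds at least 7 grains where [t] leaves
    fewer; so [v] had toppled strictly fewer times than in [t]. *)
Lemma least_action phi s t : legal phi s -> stable tri O m (final phi t) ->
  forall x, (count_mem x s <= count_mem x t)%N.
Proof.
move=> + st; elim/last_ind: s => [//|s v IH] /legal_rcons [/IH {}IH vG ge7] x.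
rewrite -cats1 count_cat /= addn0; case: eqVneq => [<-|_]; last by rewrite addn0.
have rec_le : (received v s <= received v t)%N by exact: count_mem_le.
have := st v vG; move: ge7 (IH v); rewrite !final_stateE addn1; move: rec_le.
move: (received v s) (received v t) (phi v) (count_mem v s) (count_mem v t).
by move=> *; lia.
Qed.

(** Without a relaxation every legal sequence extends, and one longer than [t] contradicts least
    action. *)
Lemma relaxation_exists phi t : stable tri O m (final phi t) ->
  exists s, relaxation tri O m phi s.
Proof.
move=> st; apply: contrapT => no_relax.
have [s ls] : exists2 s, legal phi s & size s = (size t).+1.
  elim: (size t).+1 => [|n [s ls sz]]; first by exists [::].
  have [v vG ge7] : exists2 v, inGm tri O m v & 7 <= final phi s v.
    apply: contrapT => no_v; apply: no_relax; exists s; split=> // v vG.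
    by rewrite ltNge; apply/negP => ge7; apply: no_v; exists v.
  by exists (rcons s v); [apply/legal_rcons|rewrite size_rcons sz].
rewrite -!count_predT => sz.
by have := count_mem_le predT (least_action ls st); rewrite sz ltnn.
Qed.

End Toppling.

(** * The equilateral triangle with angles [2 pi / 7] *)

Section Constants.
Variable R : realType.

Definition edge_ratio : R := 2 * cos (2 * pi / 7).
(** In an equilateral triangle the law of cosines reduces to [cos alpha = C / (1 + C)], solved here
    for [cos alpha = e / 2]. *)
Definition edge_cosh : R := edge_ratio / (2 - edge_ratio).
Local Notation e := edge_ratio.

Lemma edge_ratio_gt0 : 0 < e.
Proof.
have p0 := pi_gt0 R; rewrite mulr_gt0 // cos_gt0_pihalf //; apply/andP; split; lra.
Qed.

Lemma edge_ratio_lt2 : e < 2.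
Proof.
have p0 := pi_gt0 R.
have : 0 < sin (2 * pi / 7 : R) by rewrite sin_gt0_pi //; apply/andP; split; lra.
have := edge_ratio_gt0; have := cos2Dsin2 (2 * pi / 7 : R); rewrite /e; nra.
Qed.

(* [cos (3 t) = cos (4 t)] for [t = 2 pi / 7], as [3 t + 4 t = 2 pi]. *)
Lemma edge_ratio_cubic : e ^+ 3 + e ^+ 2 - 2 * e - 1 = 0.
Proof.
set t : R := 2 * pi / 7.
have : cos (t *+ 2 + t) = cos (t *+ 2 *+ 2).
  rewrite -[RHS]cosN -[RHS]cosD2pi; by congr cos; rewrite /t; field.
rewrite cosD !cos_mulr2n sin_mulr2n => h.
have cs := cos2Dsin2 t; have e2 := edge_ratio_lt2.
(* The factor [e - 2] is the trivial solution [t = 0] of [cos (3 t) = cos (4 t)]. *)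
have : (e - 2) * (e ^+ 3 + e ^+ 2 - 2 * e - 1) = 0.
  rewrite /e -/t in e2 *.
  have s2 : sin t ^+ 2 = 1 - cos t ^+ 2 by lra.
  have := congr1 ( *%R (cos t)) s2; lra.
by move/eqP; rewrite mulf_eq0 subr_eq0 lt_eqF //= => /eqP.
Qed.

Lemma edge_ratio_gt1 : 1 < e.
Proof.
have := edge_ratio_cubic; have := edge_ratio_gt0.
by rewrite ltNge => e0 K; apply/negP => e1; nra.
Qed.

Lemma edge_coshE : edge_cosh * (2 - e) = e.
Proof. by rewrite /edge_cosh divfK // subr_eq0 gt_eqF // edge_ratio_lt2. Qed.

Lemma edge_cosh_gt1 : 1 < edge_cosh.
Proof.
have := edge_ratio_gt1; have := edge_ratio_lt2.
by move=> h1 h2; rewrite /edge_cosh ltr_pdivlMr ?subr_gt0 //; lra.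
Qed.

(* [A], [B], [E] are the hyperbolic cosines of the side lengths. *)
Lemma equiangular (A B E c : R) : 0 < A -> 0 < B -> 0 < E -> 0 < c -> c < 1 ->
  (A * E - B) / Num.sqrt ((A ^+ 2 - 1) * (E ^+ 2 - 1)) = c ->
  (B * A - E) / Num.sqrt ((B ^+ 2 - 1) * (A ^+ 2 - 1)) = c ->
  (E * B - A) / Num.sqrt ((E ^+ 2 - 1) * (B ^+ 2 - 1)) = c ->
  [/\ A * (1 - c) = c, B = A & E = A].
Proof.
move=> A0 B0 E0 c0 c1.
(* A square root of a negative number and the inverse of 0 are both 0 by convention, so [c > 0]
   forces [X > 0]. *)
have key (u X : R) : u / Num.sqrt X = c -> 0 < u /\ u ^+ 2 = c ^+ 2 * X.
  move=> h; have X0 : 0 < Num.sqrt X.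
    rewrite lt_def sqrtr_ge0 andbT; apply: contraTneq c0 => s0.
    by rewrite -h s0 invr0 mulr0 ltxx.
  have -> : u = c * Num.sqrt X by rewrite -h divfK // gt_eqF.
  by split; [rewrite mulr_gt0|rewrite exprMn sqr_sqrtr // ltW // -sqrtr_gt0].
move=> /key [u1 e1] /key [u2 e2] /key [u3 e3].
(* Uses [x (x y - z) + (x z - y) = (x^2 - 1) y]; positivity of the products under the roots would
   still allow two negative factors. *)
have gt1 (x y z : R) : 0 < x -> 0 < y -> 0 < x * y - z -> 0 < x * z - y -> 0 < x ^+ 2 - 1.
  move=> x0 y0 h1 h2; rewrite -(pmulr_rgt0 _ y0).
  have : 0 < x * (x * y - z) by rewrite mulr_gt0.
  by lra.
have A1 : 0 < A ^+ 2 - 1 by apply: (gt1 _ E B) => //; lra.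
have B1 : 0 < B ^+ 2 - 1 by apply: (gt1 _ E A) => //; lra.
have E1 : 0 < E ^+ 2 - 1 by apply: (gt1 _ A B) => //; lra.
have c2 : 0 < 1 - c ^+ 2 by nra.
(* Each [(1 - c^2) (A^2 - 1) (E^2 - 1)] equals the symmetric expression
   [1 - A^2 - B^2 - E^2 + 2 A B E], so two such products agree and their common factor cancels. *)
have cancel (x y z : R) : 0 < z -> 0 < x -> 0 < y ->
   (1 - c ^+ 2) * (z * (x ^+ 2 - y ^+ 2)) = 0 -> x = y.
  move=> z0 x0 y0 /eqP; rewrite !mulf_eq0 (gt_eqF c2) (gt_eqF z0) /= subr_eq0.
  by rewrite eqrXn2 ?ltW // => /eqP.
have eBE : B = E by apply: (cancel _ _ (A ^+ 2 - 1)) => //; lra.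
have eBA : B = A by apply: (cancel _ _ (E ^+ 2 - 1)) => //; lra.
have eEA : E = A by rewrite -eBE.
split=> //; subst B; rewrite eEA in u1 e1.
have : A * A - A = c * (A ^+ 2 - 1).
  apply/eqP; rewrite -(@eqrXn2 _ 2) ?ltW //; last by rewrite mulr_gt0.
  by rewrite e1; apply/eqP; ring.
move=> h; have A2 : 1 < A by nra.
have : (A - 1) * (A * (1 - c) - c) = 0 by lra.
by move/eqP; rewrite mulf_eq0 !subr_eq0 gt_eqF //= => /eqP.
Qed.

End Constants.

(** * The reflection group and its triangles *)

Section Triangle.
Variable R : realType.
Notation pt := 'rV[R]_3.
Local Notation e := (edge_ratio R).
Local Notation C := (edge_cosh R).
Local Notation mirror := (mirror e).
Local Notation within := Defs.within.

Lemma ord3P (i : 'I_3) : [\/ i = 0, i = 1 | i = 2].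
Proof. by case: i => -[|[|[|//]]] ?; constructor; exact: val_inj. Qed.

(** The hyperbolic law of cosines. *)
Lemma cos_angleE (a b c : pt) : inH2 a -> inH2 b -> inH2 c ->
  cos_angle a b c =
    ((- mink a b) * (- mink a c) - (- mink b c)) /
      Num.sqrt (((- mink a b) ^+ 2 - 1) * ((- mink a c) ^+ 2 - 1)).
Proof.
move=> [aa _] [bb _] [cc _]; rewrite /cos_angle.
have mE x y : mink (x + mink a x *: a) (y + mink a y *: a) =
    mink x y + 2 * (mink a x * mink a y) + mink a x * mink a y * mink a a.
  by rewrite /mink !mxE; ring.
by rewrite !mE aa bb cc; congr (_ / Num.sqrt (_ * _)); ring.
Qed.

(** The vector [y = x - (e / 2) (p + q)] is orthogonal to [p] and [q], hence a multiple of the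
    normal, and the reflection subtracts [2 y]. *)
Lemma hrefl_mirror (p q x : pt) : inH2 p -> inH2 q ->
  mink p q = - C -> mink p x = - C -> mink q x = - C ->
  hrefl p q x = mirror p q x.
Proof.
move=> [pp _] [qq _] pq px qx; rewrite /hrefl; set n := mnormal p q.
have nn : mink n n = C ^+ 2 - 1.
  have -> : mink n n = mink p q ^+ 2 - mink p p * mink q q.
    by rewrite /mink /n /mnormal !mxE /=; ring.
  by rewrite pp qq pq; ring.
have nn0 : C ^+ 2 - 1 != 0 by have := edge_cosh_gt1 R; nra.
set y : pt := x - (e / 2) *: (p + q).
have eC := edge_coshE R.
have py : mink p y = 0.
  have -> : mink p y = mink p x - e / 2 * (mink p p + mink p q).
    by rewrite /mink !mxE; ring.
  by rewrite px pp pq; lra.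
have qy : mink q y = 0.
  have -> : mink q y = mink q x - e / 2 * (mink p q + mink q q).
    by rewrite /mink !mxE; ring.
  by rewrite qx pq qq; lra.
have xn : mink x n = mink y n.
  by rewrite /y /mink /n /mnormal !mxE /=; field.
have yn : mink n n *: y = mink y n *: n.
  have : mink n n *: y - mink y n *: n =
     (mink q y * mink p q - mink p y * mink q q) *: p +
     (mink p y * mink p q - mink q y * mink p p) *: q.
    apply/rowP => i; rewrite /mink /n /mnormal !mxE.
    move: (y) => y'.
    have [->|->|->] := ord3P i.
    - by rewrite /=; ring.
    - by rewrite /=; ring.
    - by rewrite /=; ring.
  by rewrite py qy !mul0r subrr !scale0r addr0 => /subr0_eq.
have -> : (2 * mink x n / mink n n) *: n = (2 : R) *: y.
  rewrite xn mulrAC -scalerA -yn scalerA divfK // nn //.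
by apply/rowP => i; rewrite /y /mirror !mxE; field.
Qed.

Lemma hrefl_fixl (p q : pt) : hrefl p q p = p.
Proof.
rewrite /hrefl (_ : mink p _ = 0) ?mulr0 ?mul0r ?scale0r ?subr0 //.
by rewrite /mink /mnormal !mxE /=; ring.
Qed.

Lemma hrefl_fixr (p q : pt) : hrefl p q q = q.
Proof.
rewrite /hrefl (_ : mink q _ = 0) ?mulr0 ?mul0r ?scale0r ?subr0 //.
by rewrite /mink /mnormal !mxE /=; ring.
Qed.

Lemma hrefl_linear (p q x y z : pt) :
  hrefl p q (mirror x y z) = mirror (hrefl p q x) (hrefl p q y) (hrefl p q z).
Proof.
rewrite /hrefl; set n := mnormal p q.
by apply/rowP => i; rewrite /mirror /mink !mxE; ring.
Qed.

Variable tri : 'I_3 -> pt.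
Hypothesis tri_H2 : forall i, inH2 (tri i).
Hypothesis tri_angles : forall i,
  cos_angle (tri i) (tri (i + 1)) (tri (i + 2)) = cos (2 * pi / 7).

Lemma ord3_cases (i j : 'I_3) : i != j -> j = i + 1 \/ j = i + 2.
Proof.
by case: i j => -[|[|[|//]]] ? [[|[|[|//]]] ?] //= _;
  (left; exact: val_inj) || (right; exact: val_inj).
Qed.

Lemma tri_mink i j : i != j -> mink (tri i) (tri j) = - C.
Proof.
have E1 : (1 : 'I_3) + 1 = 2 by exact: val_inj.
have E2 : (1 : 'I_3) + 2 = 0 by exact: val_inj.
have E3 : (2 : 'I_3) + 1 = 0 by exact: val_inj.
have E4 : (2 : 'I_3) + 2 = 1 by exact: val_inj.
have := (tri_angles 0, tri_angles 1, tri_angles 2).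
rewrite !add0r E1 E2 E3 E4 !cos_angleE // => -[[h0 h1] h2].
have pos x y : 0 < - mink (tri x) (tri y) by rewrite oppr_gt0 inH2_mink_lt0.
have e0 := edge_ratio_gt0 R; have e2 := edge_ratio_lt2 R.
have [] := @equiangular R (- mink (tri 0) (tri 1)) (- mink (tri 1) (tri 2))
  (- mink (tri 0) (tri 2)) (cos (2 * pi / 7)) => //.
- by move: e0; rewrite /edge_ratio; lra.
- by move: e2; rewrite /edge_ratio; lra.
- by rewrite -h1 (minkC (tri 1) (tri 0)) (minkC (tri 2) (tri 0)).
- by rewrite -h2 (minkC (tri 2) (tri 0)) (minkC (tri 2) (tri 1)).
move=> hA hB hE.
have eA : mink (tri 0) (tri 1) = - C.
  apply/eqP; rewrite -eqr_oppLR; apply/eqP.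
  rewrite /edge_cosh -[LHS](@mulfK _ (2 - e)); last by rewrite subr_eq0 gt_eqF.
  by congr (_ / _); move: hA; rewrite /edge_ratio; lra.
move: hB hE => /oppr_inj hB /oppr_inj hE.
have [->|->|->] := ord3P i; have [->|->|->] := ord3P j; rewrite ?eqxx // => _;
  by rewrite ?(minkC (tri 1) (tri 0)) ?(minkC (tri 2)) ?hB ?hE.
Qed.

Local Notation flag0 := (reach e (tri 0) (tri 1) (tri 2)).
(** The ordered triangles of the tiling: [act_flag] and [flag_act] identify them with the images of
    the given triangle. *)
Definition flag x y z := exists n, flag0 n x y z.

Lemma gram0 : gram C (tri 0) (tri 1) (tri 2).
Proof. by split=> //; split; exact: tri_mink. Qed.

Lemma flag_gram x y z : flag x y z -> gram C x y z.
Proof.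
case=> n.
exact: (reach_gram (edge_ratio_gt1 R) (edge_coshE R) (edge_cosh_gt1 R) gram0).
Qed.

Lemma flag_swap x y z : flag x y z -> flag x z y.
Proof. by case=> n h; exists n; exact: reach_swap. Qed.

Lemma flag_turn x y z : flag x y z -> flag y x z.
Proof. by case=> n h; exists n.+1; exact: reach_turn. Qed.

Lemma flag_refl x y z : flag x y z -> flag x (mirror x z y) z.
Proof. by case=> n h; exists n; exact: reach_refl. Qed.

Lemma flag_star x y z y' z' : star e x y z y' z' -> flag x y z -> flag x y' z'.
Proof. by move=> s [n h]; exists n; exact: reach_star s h. Qed.

Lemma side_refl_same i j k : i != j -> j != k -> i != k ->
  side_refl tri j (tri j) = mirror (tri i) (tri k) (tri j).
Proof.
move=> ij jk ik; rewrite /side_refl.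
have j1 : j != j + 1 by case: j {ij jk} => -[|[|[|//]]].
have j2 : j != j + 2 by case: j {ij jk j1} => -[|[|[|//]]].
have j12 : j + 1 != j + 2 by case: j {ij jk j1 j2} => -[|[|[|//]]].
rewrite hrefl_mirror ?tri_mink // 1?eq_sym //.
rewrite eq_sym in ij.
move: ik; case: (ord3_cases ij) => ->; case: (ord3_cases jk) => ->; rewrite ?eqxx // => _.
by rewrite [RHS]mirrorC.
Qed.

Lemma side_refl_fix i j : i != j -> side_refl tri j (tri i) = tri i.
Proof.
rewrite eq_sym => /ord3_cases; rewrite /side_refl.
by case=> <-; rewrite (hrefl_fixl, hrefl_fixr).
Qed.

Lemma act_mirror w x y z :
  act tri w (mirror x y z) = mirror (act tri w x) (act tri w y) (act tri w z).
Proof. by elim: w => //= i w ->; rewrite /side_refl hrefl_linear. Qed.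

Lemma act_rcons w i x : act tri (rcons w i) x = act tri w (side_refl tri i x).
Proof. by rewrite /act foldr_rcons. Qed.

(** Appending a letter [l] on the right of [w] moves to the triangle across side [l] of the current
    image, which is one mirror move. Swaps and turns bring the reflected vertex to the middle
    position. *)
Lemma act_flag w i j k : i != j -> j != k -> i != k ->
  flag (act tri w (tri i)) (act tri w (tri j)) (act tri w (tri k)).
Proof.
elim/last_ind: w i j k => [|w l IH] i j k ij jk ik.
  have h : flag (tri 0) (tri 1) (tri 2) by exists 0; exact: reach_base.
  move: ij jk ik.
  have [->|->|->] := ord3P i; have [->|->|->] := ord3P j;
    have [->|->|->] := ord3P k; rewrite ?eqxx //= => _ _ _ //.
  - exact: flag_swap.
  - exact: flag_turn.
  - exact/flag_swap/flag_turn.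
  - exact/flag_turn/flag_swap.
  - exact/flag_swap/flag_turn/flag_swap.
have main i' j' k' : i' != j' -> j' != k' -> i' != k' ->
    flag (act tri (rcons w j') (tri i')) (act tri (rcons w j') (tri j'))
      (act tri (rcons w j') (tri k')).
  move=> ij' jk' ik'; rewrite !act_rcons (side_refl_same ij' jk' ik').
  rewrite !side_refl_fix //; last by rewrite eq_sym.
  by rewrite act_mirror; apply: flag_refl; exact: IH.
have [->|il] := eqVneq l i; first by apply/flag_turn/main; rewrite // eq_sym.
have [->|jl] := eqVneq l j; first exact: main.
have -> : l = k.
  move: (ord3P i) (ord3P j) (ord3P k) (ord3P l) ij jk ik il jl.
  by do 4!case=> ->; rewrite ?eqxx.
by apply/flag_swap/main; rewrite // eq_sym.
Qed.

Lemma flag_act x y z : flag x y z -> exists w i j k,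
  [/\ i != j, j != k & i != k] /\
  [/\ x = act tri w (tri i), y = act tri w (tri j) & z = act tri w (tri k)].
Proof.
case=> n; elim=> {n x y z} [|_ x y z _ IH|_ x y z _ IH|_ x y z _ IH].
- by exists [::], 0, 1, 2.
- have [w [i [j [k [[ij jk ik] [-> -> ->]]]]]] := IH.
  by exists w, i, k, j; split; split; rewrite // eq_sym.
- have [w [i [j [k [[ij jk ik] [-> -> ->]]]]]] := IH.
  exists (rcons w j), i, j, k; split; first by split.
  rewrite !act_rcons (side_refl_same ij jk ik) act_mirror.
  by rewrite !side_refl_fix // eq_sym.
- have [w [i [j [k [[ij jk ik] [-> -> ->]]]]]] := IH.
  by exists w, j, i, k; split; split; rewrite // eq_sym.
Qed.

Lemma gadjP x y : gadj tri x y <-> exists z, flag x y z.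
Proof.
split=> [[w [i [j [ij [-> ->]]]]]|[z /flag_act [w [i [j [k [[ij _ _] [-> -> _]]]]]]]].
  have [k jk ik] : exists2 k, j != k & i != k.
    by move: ij; have [->|->|->] := ord3P i; have [->|->|->] := ord3P j => // _;
      do [by exists 0 | by exists 1 | by exists 2].
  by exists (act tri w (tri k)); exact: act_flag.
by exists w, i, j.
Qed.

Lemma gvertexP x : gvertex tri x <-> exists y z, flag x y z.
Proof.
split=> [[w [i ->]]|[y [z /flag_act [w [i [j [k [_ [-> _ _]]]]]]]]]; last by exists w, i.
exists (act tri w (tri (i + 1))), (act tri w (tri (i + 2))).
by apply: act_flag; case: i => -[|[|[|//]]].
Qed.

(** * Levels *)

Lemma flag_nbr v a b j : flag v a b -> flag v (nbr e v a b j) (nbr e v a b j.+1).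
Proof. exact/flag_star/star_nbr. Qed.

Lemma flag_same x y z y' z' : flag x y z -> flag x y' z' -> star e x y z y' z'.
Proof.
move=> h [k h']; have g := flag_gram h; case: h => n h.
exact: (reach_same_point (edge_ratio_gt1 R) (edge_ratio_cubic R) (edge_coshE R)
  (edge_cosh_gt1 R) g (reach_trans (reach_sym h) h')).
Qed.

Lemma gadj_sym x y : gadj tri x y -> gadj tri y x.
Proof. by move=> /gadjP [z h]; apply/gadjP; exists z; exact: flag_turn. Qed.

Lemma gadj_nbrP v a b x : flag v a b ->
  gadj tri v x <-> exists2 j, (j < 7)%N & x = nbr e v a b j.
Proof.
move=> h; rewrite gadjP; split=> [[z h']|[j _ ->]].
  by have [j ? [? _]] := star_nbrP (edge_ratio_cubic R) (flag_same h h'); exists j.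
by exists (nbr e v a b j.+1); exact: flag_nbr.
Qed.

Lemma nbr_add v a b i j :
  nbr e v a b (i + j) = nbr e v (nbr e v a b i) (nbr e v a b i.+1) j.
Proof. by elim: i a b => [//|i IH] a b; rewrite addSn; exact: IH. Qed.

(** Distances are measured from [a] itself, a local minimum at [v]: indices 1 and 6 have
    [D = C > 1], and [locmin_far] gives [D > C] at indices 2 to 5. *)
Lemma nbr_neq v a b k : flag v a b -> (0 < k < 7)%N -> nbr e v a b k != a.
Proof.
move=> /flag_gram [hv ha hb [va vb ab]].
have av : cosh_dist a v = C by rewrite /cosh_dist minkC va opprK.
have ab' : cosh_dist a b = C by rewrite /cosh_dist ab opprK.
have aa : cosh_dist a a = 1 by rewrite /cosh_dist (proj1 ha) opprK.
have am : cosh_dist a (mirror v a b) = C.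
  by rewrite cosh_dist_mirror av aa ab'; have := edge_coshE R; lra.
have C1 := edge_cosh_gt1 R.
have lm : locmin e a v a b by rewrite /locmin am ab' aa; split; exact: ltW.
have [] := locmin_far (edge_ratio_gt1 R) (edge_ratio_cubic R) _ _ lm.
- by rewrite av (lt_trans ltr01).
- by rewrite aa ltr01.
rewrite av => d2 d3 d4 d5 k7; apply/eqP => /(congr1 (cosh_dist a)).
rewrite aa; move: k k7 => [|[|[|[|[|[|[|//]]]]]]] //= _.
- by rewrite ab'; lra.
- by move: d2 => /=; lra.
- by move: d3 => /=; lra.
- by move: d4 => /=; lra.
- by move: d5 => /=; lra.
- by have := nbr6 (edge_ratio_cubic R) v a b; rewrite /= => ->; lra.
Qed.

Lemma nbr_uniq v a b : flag v a b -> uniq (mkseq (nbr e v a b) 7).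
Proof.
move=> h; apply/mkseq_uniqP.
have main i j : (i < j < 7)%N -> nbr e v a b i <> nbr e v a b j.
  move=> /andP [lt_ij j7]; rewrite -(subnKC (ltnW lt_ij)) nbr_add => /esym/eqP.
  by apply/negP/nbr_neq; [exact: flag_nbr|lia].
move=> i j; rewrite !inE => i7 j7 eq_ij; case: (ltngtP i j) => // lt_ij.
- by case: (main i j); rewrite ?lt_ij.
- by case: (main j i); rewrite ?lt_ij.
Qed.

Lemma within_rcons n x y :
  within tri n.+1 x y <-> within tri n x y \/ exists2 z, within tri n x z & gadj tri z y.
Proof.
elim: n x => [|n IH] x.
  split=> [[->|[z [xz <-]]]|[->|[z <- xy]]]; [by left|by right; exists x|by left|].
  by right; exists y.
split.
  case=> [->|[z [xz /IH [zy|[w zw wy]]]]]; first by left; left.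
    by left; right; exists z.
  by right; exists w => //; right; exists z.
case=> [[->|[z [xz zy]]]|[w [->|[z [xz zw]]] wy]]; first by left.
- by right; exists z; split=> //; apply/IH; left.
- by right; exists y; split=> //; left.
- by right; exists z; split=> //; apply/IH; right; exists w.
Qed.

Section Levels.
Variables (O a0 b0 : pt).
Hypothesis flagO : flag O a0 b0.
Local Notation reachO := (reach e O a0 b0).
Local Notation D := (cosh_dist O).

Lemma reach_flag n v a b : reachO n v a b -> flag v a b.
Proof. by case: flagO => k hk h; exists (k + n)%N; exact: reach_trans hk h. Qed.

(** The graph distance is the least number of turns; any flag at [v] will do because all flags at a
    point lie in one star. *)
Lemma within_reach n v a b : flag v a b ->
  within tri n O v <-> exists2 k, (k <= n)%N & reachO k v a b.
Proof.
elim: n v a b => [|n IH] v a b fv.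
  split=> [ov|[[|//] _ /reach_inv []//]].
  exists 0 => //; rewrite /= in ov; subst v.
  apply: reach_star (reach_base _ _ _ _); exact: flag_same.
rewrite within_rcons; split.
  case=> [/(IH _ _ _ fv) [k kn rk]|[z oz /gadjP [c fz]]]; first by exists k; rewrite // leqW.
  have [k kn rk] := (IH _ _ _ fz).1 oz; exists k.+1 => //.
  exact: reach_star (flag_same (flag_turn fz) fv) (reach_turn rk).
case=> k; rewrite leq_eqVlt ltnS => /predU1P [->|kn] rk; last first.
  by left; apply/(IH _ _ _ fv); exists k.
have [u [c [ru _]]] := reach_inv rk; have fu := reach_flag ru.
right; exists u; last by apply/gadjP; exists c.
by apply/(IH _ _ _ fu); exists n.
Qed.

Lemma gdist_reach n v a b : flag v a b -> gdist tri O v n ->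
  reachO n v a b /\ forall k, reachO k v a b -> (n <= k)%N.
Proof.
move=> fv [/(within_reach _ fv) [k kn rk] minn].
have min' i : reachO i v a b -> (n <= i)%N.
  by move=> ri; apply: minn; apply/(within_reach _ fv); exists i.
by split=> //; have -> : n = k; first by apply/eqP; rewrite eqn_leq kn min'.
Qed.

Lemma gdist_exists v : gvertex tri v -> exists n, gdist tri O v n.
Proof.
move=> /gvertexP [a [b fv]].
have ex : exists k, `[< within tri k O v >].
  have [i hi] := flagO; have [j hj] := fv; exists (i + j)%N; apply/asboolP.
  by apply/(within_reach _ fv); exists (i + j)%N => //; exact: reach_trans (reach_sym hi) hj.
case: (ex_minnP ex) => n /asboolP wn minn; exists n; split=> // k wk.
exact/minn/asboolP.
Qed.

Lemma gdist_inj v n k : gdist tri O v n -> gdist tri O v k -> n = k.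
Proof. by move=> [wn mn] [wk mk]; apply/eqP; rewrite eqn_leq mn // mk. Qed.

Variable lev : pt -> nat.
Hypothesis lev_dist : forall v, gvertex tri v -> gdist tri O v (lev v).

Lemma flag_vertex v a b : flag v a b -> gvertex tri v.
Proof. by move=> h; apply/gvertexP; exists a, b. Qed.

Lemma lev_adj x y : gadj tri x y -> (lev y <= (lev x).+1)%N.
Proof.
move=> xy; have /gadjP [z f] := xy.
have [wx _] := lev_dist (flag_vertex f).
have [_] := lev_dist (flag_vertex (flag_turn f)); apply.
by apply/within_rcons; right; exists x.
Qed.

Lemma levO : lev O = 0.
Proof. by have [_ /(_ 0%N erefl)] := lev_dist (flag_vertex flagO); case: (lev O). Qed.

Lemma lev_eq0 v : gvertex tri v -> lev v = 0 -> v = O.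
Proof. by move=> /lev_dist [+ _] => /[swap] ->. Qed.

Lemma within_lev n v : gvertex tri v -> within tri n O v <-> (lev v <= n)%N.
Proof.
move=> gv; have [wv minv] := lev_dist gv; split=> [|]; first exact: minv.
move: wv; elim: n => [|n IH]; first by rewrite leqn0 => + /eqP e0; rewrite e0.
move=> wv; rewrite leq_eqVlt ltnS => /predU1P [<- //|/(IH wv) wn].
by apply/within_rcons; left.
Qed.

Lemma D_gt1 v : gvertex tri v -> v <> O -> 1 < D v.
Proof.
move=> gv vO; have /gvertexP [a [b fv]] := gv.
have [] := gdist_reach fv (lev_dist gv).
case e: (lev v) => [|n] rv minv; first by have [] := reach_inv rv.
exact: (reach_gt1 (edge_ratio_gt1 R) (edge_ratio_cubic R) (edge_coshE R)
  (edge_cosh_gt1 R) (flag_gram flagO) rv minv).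
Qed.

Lemma D_gt0 v a b : flag v a b -> 0 < D v.
Proof.
have [hO _ _ _] := flag_gram flagO.
by move=> /flag_gram [hv _ _ _]; exact: cosh_dist_gt0.
Qed.

Lemma parent v : gvertex tri v -> v <> O -> exists a b,
  [/\ flag v a b, lev v = (lev a).+1, locmin e O v a b & D a < D v].
Proof.
move=> gv vO; have /gvertexP [a [b fv]] := gv.
have [] := gdist_reach fv (lev_dist gv).
case E: (lev v) => [|n] rv minv; first by have [] := reach_inv rv.
have [hO _ _ _] := flag_gram flagO.
have [a' [b' [sv ra lm lt_a]]] := descent (edge_ratio_gt1 R) (edge_ratio_cubic R)
  (edge_coshE R) (edge_cosh_gt1 R) hO (flag_gram flagO) rv minv.
have fv' := flag_star sv fv; exists a', b'; split=> //.
have ga := flag_vertex (flag_turn fv').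
congr S; apply: (gdist_inj _ (lev_dist ga)); split.
  by apply/(within_reach _ (flag_turn fv')); exists n.
move=> k /(within_reach _ (flag_turn fv')) [i ik ri]; apply: leq_trans ik.
by rewrite -ltnS; apply: minv; exact: reach_star (star_sym sv) (reach_turn ri).
Qed.

(** The parent of [v] is closer to [O] than [v], so [locmin_far] leaves only the indices 0, 1 and 6;
    as a local minimum it is no farther than [a] in the last two cases. *)
Lemma lev_locmin v a b : flag v a b -> v <> O -> locmin e O v a b ->
  [\/ lev v = (lev a).+1, lev v = (lev b).+1 /\ D b <= D a |
      lev v = (lev (mirror v a b)).+1 /\ D (mirror v a b) <= D a].
Proof.
move=> fv vO lm; have [a' [b' [fv' lv lm' lt_a']]] := parent (flag_vertex fv) vO.
have [f2 f3 f4 f5] := locmin_far (edge_ratio_gt1 R) (edge_ratio_cubic R)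
  (D_gt0 fv) (D_gt0 (flag_turn fv)) lm.
have [j j7 [ea eb]] := star_nbrP (edge_ratio_cubic R) (flag_same fv fv').
have le_prev : D a' <= D (mirror v a' (nbr e v a b j.+1)).
  by case: eb lm' => -> [] //; rewrite mirrorK.
have le_next : D a' <= D (nbr e v a b j.+1).
  by case: eb lm' => -> []; rewrite ?mirrorK.
move: j j7 ea {eb} le_prev le_next => [|[|[|[|[|[|[|//]]]]]]] _ ea;
  rewrite ?ea in lv lt_a' *.
- by move=> _ _; constructor 1.
- by rewrite -nbr_pred => ? _; constructor 2.
- by move: (lt_trans lt_a' f2); rewrite ltxx.
- by move: (lt_trans lt_a' f3); rewrite ltxx.
- by move: (lt_trans lt_a' f4); rewrite ltxx.
- by move: (lt_trans lt_a' f5); rewrite ltxx.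
- rewrite (nbr7 (edge_ratio_cubic R)) (nbr6 (edge_ratio_cubic R)) in lv *.
  by move=> _ ?; constructor 3.
Qed.

(** The closer to [O] of [v] and index 1 is a local minimum at index 2. Its neighbour on the other
    side is strictly farther, which excludes the third outcome of [lev_locmin]. *)
Lemma lev_nbr2 v a b : flag v a b -> v <> O -> locmin e O v a b ->
  lev (nbr e v a b 2) = (lev v).+1 \/
  lev (nbr e v a b 2) = (lev (nbr e v a b 1)).+1.
Proof.
move=> fv vO lm; have [v0 a0' b0'] := And3 (D_gt0 fv) (D_gt0 (flag_turn fv))
  (D_gt0 (flag_turn (flag_swap fv))).
have [f2 f3 _ _] := locmin_far (edge_ratio_gt1 R) (edge_ratio_cubic R) v0 a0' lm.
have fx : flag (nbr e v a b 2) v (nbr e v a b 1).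
  exact/flag_turn/flag_swap/(flag_nbr 1).
have e1 := edge_ratio_gt1 R.
have xO : nbr e v a b 2 <> O.
  move=> xO; have := D_gt1 (flag_vertex fv) vO; move: f2; rewrite xO.
  have [hO _ _ _] := flag_gram flagO; rewrite {2}/cosh_dist (proj1 hO) opprK; lra.
have m3 : mirror (nbr e v a b 2) v (nbr e v a b 1) = nbr e v a b 3.
  by rewrite mirrorC [RHS]nbrSS.
have [le1|lt1] := leP (D v) (D (nbr e v a b 1)).
  have lm2 : locmin e O (nbr e v a b 2) v (nbr e v a b 1).
    by split; rewrite ?m3 // ltW.
  have [|[? _]|[_]] := lev_locmin fx xO lm2.
  - by left.
  - by right.
  - by rewrite m3 leNgt f3.
have lm2 := locmin_nbr2_turn e1 (edge_ratio_cubic R) v0 a0' lm lt1.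
have [|[? _]|[_]] := lev_locmin (flag_swap fx) xO lm2.
- by right.
- by left.
- rewrite leNgt cosh_dist_mirror => /negP []; rewrite -/(nbr e v a b 1) in lt1 *.
  by move: b0' f2 lt1; rewrite [nbr e v a b 1]/=; nra.
Qed.

(** The points [b], [v], [c], [d], [mirror a d c] are consecutive neighbours of [a]; the recurrence
    around [a] expresses [D d - D a] by [D c - D b >= 0] and positive terms. *)
Lemma nbr6_far v a b : flag v a b -> D b <= D (mirror v a b) ->
  D a < D (mirror (mirror v a b) a v).
Proof.
move=> fv; set c := mirror v a b => bc; set d := mirror c a v.
have fc : flag a v c by exact/flag_turn/flag_star/fv/star_mirror.
have fd : flag a d c by rewrite /d mirrorC; exact: flag_refl.
have ff : flag a (mirror a d c) d by exact/flag_refl/flag_swap.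
have f0 := D_gt0 (flag_turn ff); have pa := D_gt0 fc.
have Dd : D d = e * (D c + D a) - D v by rewrite cosh_dist_mirror.
have Df : D (mirror a d c) = e * (D a + D d) - D c by rewrite cosh_dist_mirror.
have Db : D b = e * (D v + D a) - D c by rewrite -cosh_dist_mirror mirrorK.
have e1 := edge_ratio_gt1 R; have K := edge_ratio_cubic R.
move: (D d) (D (mirror a d c)) Dd Df f0 => x y Dd Df f0.
(* Modulo the vanishing cubic; [e ^+ 2 - 1 = sin (3 t) / sin t] for [t = 2 pi / 7]. *)
have -> : x = D a + ((e ^+ 2 - 1) * (D c - D b)
     - (e ^+ 3 + e ^+ 2 - 2 * e - 1) * (D c - D v) + (e - 1) * (y + D a)).
  by rewrite Df Dd Db; ring.
rewrite K mul0r subr0 ltrDl ltr_wpDl //.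
  by rewrite mulr_ge0 // ?subr_ge0 // expr_ge1 // ltW // (lt_trans ltr01).
by apply: mulr_gt0; [rewrite subr_gt0|apply: addr_gt0].
Qed.

(** With [a] the parent, [b] is taken on the side closer to [O], so that a second neighbour one
    level below can only be [b]. *)
Lemma nbr_levels v : gvertex tri v -> v <> O -> exists a b,
  [/\ flag v a b, lev v = (lev a).+1, lev (nbr e v a b 6) = lev v,
      (lev v <= lev (nbr e v a b 2))%N &
      [/\ lev (nbr e v a b 3) = (lev v).+1, lev (nbr e v a b 4) = (lev v).+1 &
          lev (nbr e v a b 5) = (lev v).+1]].
Proof.
move=> gv vO; have [a [b' [fv' lva lm' lt_a]]] := parent gv vO.
have [b [fv lm bc]] : exists b, [/\ flag v a b, locmin e O v a b & D b <= D (mirror v a b)].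
  have [le|/ltW lt] := leP (D b') (D (mirror v a b')); first by exists b'.
  exists (mirror v a b'); rewrite mirrorK; split=> //.
    exact: flag_star (star_mirror _ _ _ _) fv'.
  exact: locmin_mirror.
exists a, b; have K := edge_ratio_cubic R; have e1 := edge_ratio_gt1 R.
have fm : flag v a (mirror v a b) by exact: flag_star (star_mirror _ _ _ _) fv.
have v0 := D_gt0 fv; have pa := D_gt0 (flag_turn fv).
have [f2 f3 f4 f5] := locmin_far e1 K v0 pa lm.
have v1 := D_gt1 gv vO.
have DO : D O = 1.
  by have [hO _ _ _] := flag_gram flagO; rewrite /cosh_dist (proj1 hO) opprK.
have nO x : D v < D x -> x <> O by move=> h xO; move: h; rewrite xO DO; lra.
(* Among three consecutive neighbours farther than [v], the middle one has [v] as a strict local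
   minimum and hence as parent; this settles indices 3 and 4. *)
have flat i : D v < D (nbr e v a b i) -> D v < D (nbr e v a b i.+1) ->
    D v < D (nbr e v a b i.+2) -> lev (nbr e v a b i.+1) = (lev v).+1.
  move=> h0 h1 h2; have fi := flag_turn (flag_nbr i.+1 fv).
  have Em : mirror (nbr e v a b i.+1) v (nbr e v a b i.+2) = nbr e v a b i.
    by rewrite mirrorC -nbr_pred.
  have lmi : locmin e O (nbr e v a b i.+1) v (nbr e v a b i.+2).
    by split; rewrite ?Em ltW.
  have [//|[_]|[_]] := lev_locmin fi (nO _ h1) lmi; first by rewrite leNgt h2.
  by rewrite Em leNgt h0.
have l6 : lev (nbr e v a b 6) = lev v.
  rewrite nbr6 // lva; set c := mirror v a b.
  have fc : flag c a v by exact/flag_swap/flag_turn/flag_swap.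
  have da := nbr6_far fv bc.
  have cO : c <> O.
    move=> cO; have := edge_cosh_gt1 R.
    have [_ _ _ [ca _ _]] := flag_gram fc.
    have [_ ac] := lm; move: ac; rewrite -/c cO DO.
    by rewrite cO in ca; rewrite /cosh_dist ca; lra.
  (* Around [c], both vertices next to [a] are strictly farther than [a], so [a] is the parent. *)
  have lmc : locmin e O c a v by split; apply: ltW.
  have [//|[_]|[_]] := lev_locmin fc cO lmc; first by rewrite leNgt lt_a.
  by rewrite leNgt da.
have l1 x y z : flag v x y -> z = x -> (lev v <= (lev z).+1)%N.
  by move=> f ->; apply: lev_adj; apply/gadjP; exists y; exact: flag_turn.
split=> //.
- have [->//|->] := lev_nbr2 fv vO lm; apply: (l1 b a) => //; exact: flag_swap.
- split; [exact: flat|exact: flat|].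
  (* Index 5 is index 2 in the reversed order; its parent is [v] or index 6, which have equal
     levels. *)
  have := lev_nbr2 fm vO (locmin_mirror lm).
  by rewrite !nbr_mirror // l6; case.
Qed.

(** * The toppling function *)

Variable m : nat.
Local Notation inball := (inGm tri O m).

Lemma within_vertex n x y : gvertex tri x -> within tri n x y -> gvertex tri y.
Proof.
elim: n x => [|n IH] x gx /=; first by move=> <-.
case=> [<- //|[z [/gadjP [c fz] zy]]]; apply: IH zy.
exact: flag_vertex (flag_turn fz).
Qed.

Lemma ball_finite n :
  exists2 B : seq pt, uniq B & forall x, within tri n O x <-> x \in B.
Proof.
have [l hl] : exists l : seq pt, forall x, within tri n O x -> x \in l.
  elim: n => [|n [l hl]]; first by exists [:: O] => x /= ->; rewrite mem_head.
  have [z zl|l' hl'] := @seq_of_family _ (fun z x => gvertex tri z /\ gadj tri z x) l.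
    have [/gvertexP [a [b fz]]|ngz] := pselect (gvertex tri z); last first.
      by exists [::] => y [].
    exists (mkseq (nbr e z a b) 7) => y [_ /(gadj_nbrP _ fz) [j j7 ->]].
    by apply/mapP; exists j; rewrite // mem_iota.
  exists (l ++ l') => x /within_rcons [/hl xl|[z oz zx]]; rewrite mem_cat ?xl //.
  rewrite (hl' z x) ?orbT ?hl //; split=> //.
  exact: within_vertex (flag_vertex flagO) oz.
exists [seq x <- undup l | `[< within tri n O x >]].
  by rewrite filter_uniq // undup_uniq.
move=> x; rewrite mem_filter mem_undup; split=> [wx|/andP [/asboolP //]].
by rewrite asboolT //= hl.
Qed.

Lemma received_nbr v a b s : flag v a b -> inball v ->
  received tri O m v s = (\sum_(0 <= i < 7) count_mem (nbr e v a b i) s)%N.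
Proof.
move=> fv bv; have := nbr_uniq fv => /count_in_seq => /(_ s).
rewrite big_map /= /index_iota subn0 => <-.
apply: eq_count => x; apply/asboolP/mapP.
  move=> [/gadj_sym/(gadj_nbrP _ fv) [j j7 ->] _].
  by exists j; rewrite // mem_iota.
move=> [j]; rewrite mem_iota => /= j7 ->; split=> //; apply: gadj_sym.
by apply/(gadj_nbrP _ fv); exists j.
Qed.

Variables (P : seq pt) (lP : nat).
Hypothesis P_uniq : uniq P.
Hypothesis P_ball : forall p, p \in P -> inball p.
Hypothesis P_lev : forall p, p \in P -> (lP <= lev p)%N.

(** Truncated subtraction makes it vanish outside the ball, so summing over all seven neighbours
    agrees with summing inside the ball. *)
Definition profile v := minn (m.+1 - lev v) (m.+1 - lP).

Lemma nbr_sum (f : pt -> nat) v a b :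
  (\sum_(0 <= i < 7) f (nbr e v a b i) =
   f a + f (nbr e v a b 1) + f (nbr e v a b 2) + f (nbr e v a b 3)
   + f (nbr e v a b 4) + f (nbr e v a b 5) + f (nbr e v a b 6))%N.
Proof. by rewrite !big_nat_recr //= big_nil add0n. Qed.

Lemma flag_irrefl x z : ~ flag x x z.
Proof.
move=> /flag_gram [[xx _] _ _ [xx' _ _]].
by have := edge_cosh_gt1 R; move: xx'; rewrite xx; lra.
Qed.

(** From level [lP] on, at most two neighbours gain one, two do not gain and three lose one, which
    pays for a grain of [P]. Below [lP] the profile is maximal and [P] is absent; at [O] every
    neighbour has positive level. *)
Lemma profile_nbr_sum v : inball v -> exists a b, flag v a b /\
  (\sum_(0 <= i < 7) profile (nbr e v a b i) + (v \in P) <= 7 * profile v)%N.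
Proof.
move=> bv; have gv := within_vertex (flag_vertex flagO) bv.
have vP : (v \in P) -> (lP <= lev v)%N := @P_lev v.
have lev_v : (lev v <= m)%N by exact/(within_lev _ gv).
have [vO|vO] := pselect (v = O).
  subst v; exists a0, b0; split=> //; rewrite nbr_sum.
  have lev1 i : (0 < lev (nbr e O a0 b0 i))%N.
    have fi := flag_nbr i flagO; rewrite lt0n; apply/eqP => l0.
    have := lev_eq0 (flag_vertex (flag_turn fi)) l0 => iO.
    by move: fi; rewrite iO; exact: flag_irrefl.
  rewrite levO in vP lev_v.
  have le i : (profile (nbr e O a0 b0 i) + (O \in P) <= profile O)%N.
    move: (lev1 i); rewrite /profile levO; case: (O \in P) vP => [/(_ isT)|_]; lia.
  have := (le 0, le 1, le 2, le 3, le 4, le 5, le 6)%N.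
  by rewrite [nbr _ _ _ _ 0]/= => -[[[[[[]]]]]]; case: (O \in P); lia.
have [a [b [fv l0 l6 l2 [l3 l4 l5]]]] := nbr_levels gv vO.
exists a, b; split=> //; rewrite nbr_sum.
have l1 : (lev v <= (lev (nbr e v a b 1)).+1)%N.
  by apply: lev_adj; apply: gadj_sym; apply/(gadj_nbrP _ fv); exists 1.
have [lt|ge] := ltnP (lev v) lP.
  have -> : (v \in P) = false by apply/negP => /vP; lia.
  have le y : (profile y <= profile v)%N by rewrite /profile; lia.
  have := (le a, le (nbr e v a b 1), le (nbr e v a b 2), le (nbr e v a b 3),
    le (nbr e v a b 4), le (nbr e v a b 5), le (nbr e v a b 6)).
  by move=> -[[[[[[]]]]]]; lia.
have up y : (lev v <= (lev y).+1)%N -> (profile y <= (profile v).+1)%N.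
  by rewrite /profile; lia.
have flat y : (lev v <= lev y)%N -> (profile y <= profile v)%N.
  by rewrite /profile; lia.
have down y : lev y = (lev v).+1 -> (profile y < profile v)%N.
  by rewrite /profile; lia.
move: {l1 l2 l3 l4 l5 l0 l6} (up _ l1) (flat _ l2) (down _ l3) (down _ l4) (down _ l5)
  (up a (eq_leq l0)) (flat _ (eq_leq (esym l6))); case: (v \in P) {vP up flat down}; lia.
Qed.

Lemma profile_stabilizes : exists t,
  stable tri O m (final_state tri O m (phimP P) t) /\
  forall v, gvertex tri v -> count_mem v t = profile v.
Proof.
have [B uB hB] := ball_finite m.
(* The order is arbitrary and need not be legal, as [least_action] allows. *)
exists (flatten [seq nseq (profile y) y | y <- B]).
have cnt v : gvertex tri v ->
    count_mem v (flatten [seq nseq (profile y) y | y <- B]) = profile v.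
  move=> gv; rewrite count_mem_flatten_nseq //.
  have [|vB] := boolP (v \in B); first by rewrite mul1n.
  rewrite mul0n /profile; suff : (m < lev v)%N by lia.
  by rewrite ltnNge; apply: contra vB => /(within_lev _ gv) /hB.
split=> // v bv; have gv := within_vertex (flag_vertex flagO) bv.
have [a [b [fv le]]] := profile_nbr_sum bv.
rewrite final_stateE (received_nbr _ fv) // cnt // /phimP count_uniq_mem //.
have -> : (\sum_(0 <= i < 7) count_mem (nbr e v a b i)
      (flatten [seq nseq (profile y) y | y <- B]) =
    \sum_(0 <= i < 7) profile (nbr e v a b i))%N.
  by apply: eq_bigr => i _; rewrite cnt //; exact: flag_vertex (flag_turn (flag_nbr i fv)).
move: le; move: (profile v) (bigop _ _ _) => x y.
by case: (v \in P) => /=; lia.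
Qed.

Lemma profile_lower s (p : pt) : p \in P -> lev p = lP ->
  relaxation tri O m (phimP P) s ->
  forall v, inball v -> (profile v <= count_mem v s)%N.
Proof.
move=> pP lp [_ st].
have gp := within_vertex (flag_vertex flagO) (P_ball pP).
(* Layer by layer: the count is at least [d] on the ball of radius [m + 1 - d]. *)
have key d : (d <= m.+1 - lP)%N -> forall v, gvertex tri v ->
    (lev v <= m.+1 - d)%N -> (d <= count_mem v s)%N.
  elim: d => [//|d IH] dm v gv lv; rewrite ltnNge; apply/negP => cv.
  have {}IH x : gvertex tri x -> (lev x <= m.+1 - d)%N -> (d <= count_mem x s)%N.
    by apply: IH; exact: ltnW.
  (* The points where the next bound [d + 1] fails, in the ball of radius [m - d]. *)
  pose Z x := [/\ gvertex tri x, (lev x <= m.+1 - d.+1)%N & (count_mem x s <= d)%N].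
  (* Stability bounds the neighbour sum plus [[x in P]] by [7 d], while each neighbour has at least
     [d]: hence equality at every neighbour and [x] outside [P]. *)
  have Zstep x : Z x -> x \notin P /\ forall y, gadj tri x y -> (count_mem y s <= d)%N.
    move=> [gx lx cx]; have bx : inball x by apply/(within_lev _ gx); lia.
    have /gvertexP [a [b fx]] := gx.
    have fi i := flag_turn (flag_nbr i fx).
    have ge i : (d <= count_mem (nbr e x a b i) s)%N.
      apply: IH; first exact: flag_vertex (fi i).
      have : gadj tri x (nbr e x a b i).
        by apply: gadj_sym; apply/gadjP; exists (nbr e x a b i.+1).
      by move=> /lev_adj; lia.
    have := st x bx; rewrite final_stateE (received_nbr _ fx) //.
    rewrite (nbr_sum (fun y => count_mem y s)) /phimP count_uniq_mem //.
    have := (ge 0, ge 1, ge 2, ge 3, ge 4, ge 5, ge 6)%N; rewrite [nbr _ _ _ _ 0]/=.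
    move=> -[[[[[[g0 g1] g2] g3] g4] g5] g6] stx.
    split=> [|y /(gadj_nbrP _ fx) [j j7 ->]].
      by apply/negP => xP; move: stx cx g0 g1 g2 g3 g4 g5 g6; rewrite xP; lia.
    move: stx cx g0 g1 g2 g3 g4 g5 g6; case: (x \in P);
      move: j j7 => [|[|[|[|[|[|[|//]]]]]]] _; rewrite ?[nbr _ _ _ _ 0]/=; lia.
  (* Failure propagates from [v] down the chain of parents to [O]. *)
  have ZO : Z O.
    have Zv : Z v by split=> //; lia.
    move En: (lev v) => n; elim: n {gv lv cv} v Zv En => [|n IHn] x Zx En.
      by have [gx _ _] := Zx; rewrite -(lev_eq0 gx En).
    have [gx lx _] := Zx; have xO : x <> O by move=> xO; move: En; rewrite xO levO.
    have [a [b [fx la _ _]]] := parent gx xO.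
    apply: (IHn a); last lia; split; [exact: flag_vertex (flag_turn fx)|lia|].
    by have [_] := Zstep x Zx; apply; apply/gadjP; exists b.
  (* From [O] it propagates up again to the whole ball of radius [m - d], which contains [p] since
     [lP <= m - d]. *)
  have Zall n x : gvertex tri x -> lev x = n -> (n <= m.+1 - d.+1)%N -> Z x.
    elim: n x => [|n IHn] x gx lx ln; first by rewrite (lev_eq0 gx lx).
    have xO : x <> O by move=> xO; move: lx; rewrite xO levO.
    have [a [b [fx la _ _]]] := parent gx xO.
    have Za : Z a.
      by apply: IHn; [exact: flag_vertex (flag_turn fx)|lia|exact: ltnW].
    split; rewrite ?lx //; have [_] := Zstep a Za; apply.
    by apply/gadjP; exists b; exact: flag_turn.
  have /Zstep [] : Z p by apply: (Zall lP); rewrite ?lp //; lia.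
  by rewrite pP.
move=> v bv; have gv := within_vertex (flag_vertex flagO) bv.
apply: key => //; rewrite /profile; first exact: geq_minr.
have : (lev v <= m)%N by exact/(within_lev _ gv).
by lia.
Qed.

Lemma relaxation_profile (p : pt) : p \in P -> lev p = lP ->
  (exists s, relaxation tri O m (phimP P) s) /\
  forall s, relaxation tri O m (phimP P) s ->
    forall v, inball v -> count_mem v s = profile v.
Proof.
move=> pP lp; have [t [st ct]] := profile_stabilizes.
split=> [|s rs v bv]; first exact: relaxation_exists st.
have gv := within_vertex (flag_vertex flagO) bv.
apply/eqP; rewrite eqn_leq (profile_lower pP lp rs bv) andbT -(ct v gv).
by have [ls _] := rs; exact: least_action ls st v.
Qed.

End Levels.

End Triangle.

Unset Implicit Arguments.

Theorem theorem2p5 (R : realType) (tri : 'I_3 -> 'rV[R]_3)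
  (Htri_H2 : forall i, inH2 (tri i))
  (Htri_angles : forall i,
     cos_angle (tri i) (tri (i + 1)) (tri (i + 2)) = cos (2 * pi / 7))
  (O : 'rV[R]_3) (HO : gvertex tri O)
  (m : nat) (P : seq 'rV[R]_3)
  (HPne : P != [::]) (HPuniq : uniq P)
  (HPsub : forall p, p \in P -> inGm tri O m p) :
  (exists s, relaxation tri O m (phimP P) s) /\
  (forall s, relaxation tri O m (phimP P) s ->
     forall v, inGm tri O m v ->
     forall lv lP, gdist tri O v lv -> gdistP tri O P lP ->
     count_mem v s = minn (m.+1 - lv) (m.+1 - lP)).
Proof.
have [a [b fO]] := (gvertexP Htri_H2 Htri_angles O).1 HO.
have vertex x : inGm tri O m x -> gvertex tri x by exact: within_vertex HO.
(* A total level function; 0 is a dummy value off the vertices. *)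
have [lev lev_dist] : {lev : 'rV[R]_3 -> nat &
    forall v, gvertex tri v -> gdist tri O v (lev v)}.
  apply: (@choice _ _ (fun v n => gvertex tri v -> gdist tri O v n)) => v.
  have [gv|ngv] := pselect (gvertex tri v); last by exists 0.
  by have [n hn] := gdist_exists Htri_H2 Htri_angles fO gv; exists n.
have ex_lP : exists n, has (fun p => lev p == n) P.
  by case: P HPne {HPuniq HPsub} => // p P' _; exists (lev p); rewrite /= eqxx.
case: (ex_minnP ex_lP) => lP /hasP [p pP /eqP lp] min_lP.
have P_lev q : q \in P -> (lP <= lev q)%N.
  by move=> qP; apply: min_lP; apply/hasP; exists q.
have [ex counts] := relaxation_profile Htri_H2 Htri_angles fO lev_dist
  HPuniq HPsub P_lev pP lp.
split=> // s rs v bv lv lQ dv [[q qP dq] min_lQ].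
rewrite (counts s rs v bv) /profile (gdist_inj dv (lev_dist v (vertex v bv))).
congr (minn _ (_ - _)); apply/eqP; rewrite eqn_leq.
rewrite (min_lQ p) // -?lp; last exact/lev_dist/vertex/HPsub.
by rewrite lp (gdist_inj dq (lev_dist q (vertex q (HPsub q qP)))) P_lev.
Qed.
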